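(* If every poset of size $\omega_1$ with precaliber $\omega_1$ is $\sigma$-centered (the assertion $\mathrm{P}_{\omega_1}(\text{precaliber }\omega_1\to\sigma\text{-centered})$), then $\mathrm{MA}_{\omega_1}(\text{precaliber }\omega_1)$ holds.
   Context: A poset is a partially ordered set. A subset $X$ of a poset $\mathcal{P}$ is centered if every finite subset of $X$ has a common lower bound in $\mathcal{P}$. $\mathcal{P}$ has precaliber $\omega_1$ if every uncountable subset of $\mathcal{P}$ has an uncountable centered subset. $\mathcal{P}$ is $\sigma$-centered if it is a countable union of centered subsets. $\mathrm{MA}_{\omega_1}(\text{precaliber }\omega_1)$ is the assertion that for every poset $\mathcal{P}$ with precaliber $\omega_1$ and every collection $\mathcal{X}$ of $\omega_1$ many dense subsets of $\mathcal{P}$ there is a filter $G\subseteq\mathcal{P}$ with $G\cap D\ne\emptyset$ for all $D\in\mathcal{X}$. Here dense means downward cofinal, and a filter is an upward closed subset any finitely many elements of which have a common lower bound in it. *)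

(* Defs.v *)
From mathcomp Require Import all_boot all_order.
From mathcomp Require Import boolp classical_sets functions cardinality wochoice.

Set Implicit Arguments.
Unset Strict Implicit.
Unset Printing Implicit Defensive.

Local Open Scope classical_set_scope.
Local Open Scope card_scope.

(* [W], ordered by [R] (a non-strict relation), has order type omega_1:
   omega_1 is the unique uncountable ordinal all of whose proper initial
   segments are countable. The segment below includes its top element [w]. *)
Definition omega1_order (W : Type) (R : rel W) : Prop :=
  [/\ well_order R, ~ countable [set: W] & forall w, countable [set v | R v w]].

Definition card_omega1 (T : Type) (A : set T) : Prop :=
  exists (W : Type) (R : rel W), omega1_order R /\ A #= [set: W].

Section Posets.
Context (d : Order.disp_t) (P : porderType d).

(* The finite subset [F] may be empty. *)
Definition centered (X : set P) : Prop :=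
  forall F : set P, finite_set F -> F `<=` X -> exists p : P, lbound F p.

Definition precaliber_omega1 : Prop :=
  forall X : set P, ~ countable X ->
    exists Y : set P, [/\ Y `<=` X, ~ countable Y & centered Y].

Definition sigma_centered : Prop :=
  exists C : set (set P),
    [/\ countable C, forall X, C X -> centered X & \bigcup_(X in C) X = [set: P]].

Definition downward_cofinal (D : set P) : Prop :=
  forall p : P, exists2 q : P, D q & (q <= p)%O.

(* Taking [F] empty in the second clause makes a filter nonempty. *)
Definition poset_filter (G : set P) : Prop :=
  (forall p q : P, G p -> (p <= q)%O -> G q) /\
  (forall F : set P, finite_set F -> F `<=` G -> exists2 p : P, G p & lbound F p).

End Posets.

Arguments precaliber_omega1 {d} P.
Arguments sigma_centered {d} P.

(* A [porderType] also carries decidable equality and a choice operator; under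
   the classical axioms of [boolp] every type has both, so these quantifiers
   range over all partially ordered sets. *)
Definition P_omega1_precaliber_sigma_centered : Prop :=
  forall (d : Order.disp_t) (P : porderType d),
    card_omega1 [set: P] -> precaliber_omega1 P -> sigma_centered P.

Definition MA_omega1_precaliber : Prop :=
  forall (d : Order.disp_t) (P : porderType d), precaliber_omega1 P ->
  forall X : set (set P), card_omega1 X ->
    (forall D, X D -> downward_cofinal D) ->
  exists G : set P, poset_filter G /\ forall D, X D -> G `&` D !=set0.

(* Main.v *)
Require Import Defs.
From HB Require Import structures.
From mathcomp Require Import all_boot all_order.
From mathcomp Require Import boolp classical_sets functions cardinality.
From mathcomp Require Import wochoice.

Set Implicit Arguments.
Unset Strict Implicit.
Unset Printing Implicit Defensive.

Import Order.TTheory.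

Local Open Scope classical_set_scope.
Local Open Scope order_scope.

(** Let [P] have precaliber [omega_1] and let [D w], [w < omega_1], be dense in
    [P]. The task is to find a centered set meeting all [D w] which is moreover
    directed; its upward closure is then the required filter.

    Reduction. Closing under a function that picks a lower bound in [D w] of
    a bounded finite set yields [P0], a subset of [P] of size at most [omega_1]
    in which finite sets bounded in [P] are already bounded ([hull]). Antichains
    of [P] are countable, so each dense subset of [P0] contains a countable
    predense sequence ([countable_predense]). Besides the sequences inside the
    [D w], take for all [a], [b] in [P0] one whose terms lie below both or are
    incompatible with one of them: a centered set meeting these is directed. It
    remains to meet, by one centered set, [omega_1] many predense sequences.

    The auxiliary poset. Fix for each [x < omega_1] a ladder [eta x] climbing to
    [x], a real [u x], different for different [x], and an enumeration [idx x]
    of the countably many sequences introduced up to stage [x]. A condition is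
    a pair of some [p] in [P0] and a finite set [G] of ordinals; whenever
    distinct [x], [y] in [G] have the same [k]-th ladder point, [p] must lie
    below the [n]-th term of the sequence [idx x k] for some [n] such that [u x]
    and [u y] agree below [n]. As the reals are distinct, this leaves finitely
    many possible [n]: two ordinals sharing a ladder point confine a whole
    sequence to finitely many of its terms.

    This poset has precaliber [omega_1] ([condition_precaliber]): an uncountable
    set of conditions can be thinned so that ladders of ordinals taken from
    different conditions meet only below a fixed index [N]. For these finitely
    many indices one extends [p] to choose the terms, and Fodor's lemma makes
    the finitely many relevant data (ladder points, terms chosen, initial parts
    of the reals) constant, so that conditions amalgamate.

    The hypothesis therefore applies, and the poset is a countable union of
    centered sets. One piece contains conditions with side [set x] for
    all [x] in a stationary set [X]. By Fodor's lemma again, all but a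
    nonstationary set of [x] in [X] share each of their ladder points with some
    other member of [X] ([partners]); hence along the piece every sequence is
    confined to finitely many terms, and a compactness argument selects one term
    of each coherently ([generic_of_sigma_centered]).

    The contrast driving the proof is that thinning to an uncountable set makes
    ladders almost disjoint, whereas a stationary set never does. *)

(** * Countable sets and finite character *)

Lemma sub_countable_set T (A B : set T) :
  A `<=` B -> countable B -> countable A.
Proof. by move=> /subset_card_le; exact: sub_countable. Qed.

Lemma countable_image T U (f : T -> U) (A : set T) :
  countable A -> countable (f @` A).
Proof. exact: sub_countable (card_image_le f A). Qed.

Lemma countable_setU T (A B : set T) :
  countable A -> countable B -> countable (A `|` B).
Proof.
move=> cA cB; pose F (b : bool) := if b then A else B.
apply: (@sub_countable_set _ _ (\bigcup_b F b)).
  by move=> x [Ax|Bx]; [exists true|exists false].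
by apply: bigcup_countable => // -[].
Qed.

Lemma countable_range T (A : set T) : countable A -> A !=set0 ->
  exists f : nat -> T, A = range f.
Proof.
move=> /countable_injP[g ginj] [x0 Ax0].
have /choice[f fP] (n : nat) :
    exists x, A x /\ forall y, A y -> g y = n -> y = x.
  have [[x [Ax gx]]|no] := pselect (exists x, A x /\ g x = n).
    by exists x; split=> // y Ay gy; apply: ginj; rewrite ?inE// gx.
  by exists x0; split=> // y Ay gy; case: no; exists y.
exists f; apply/seteqP; split=> [x Ax|_ [n _ <-]]; last by have [] := fP n.
by exists (g x) => //; apply/esym/(fP (g x)).2.
Qed.

(** The Teichmueller-Tukey lemma, from Zorn's lemma: a finite subset of the
    union of a chain lies in one member of the chain. *)
Lemma finite_character_maximal T (C : set T -> Prop) : C set0 ->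
    (forall A, C A <-> forall F, finite_set F -> F `<=` A -> C F) ->
  exists A, C A /\ forall x, C (x |` A) -> A x.
Proof.
move=> C0 Cfin.
have [F FC totF|A [CA Amax]] := @Zorn_bigcup T C.
  apply/Cfin => X finX XF; have [[x Xx]|X0] := pselect (X !=set0); last first.
    suff -> : X = set0 by [].
    by apply/seteqP; split=> x // Xx; case: X0; exists x.
  suff [Y FY XY] : exists2 Y, F Y & X `<=` Y by exact: ((Cfin Y).1 (FC _ FY)).
  have [Y0 FY0 _] := XF _ Xx.
  elim/Pchoice: T => T in C C0 Cfin F FC totF X finX XF x Xx Y0 FY0 *.
  have [s Xs] := (finite_seqP _).1 finX; move: XF; rewrite Xs => {Xx Xs}.
  elim: s => [|y s IHs] sF; first by exists Y0 => // y.
  have [|Y FY sY] := IHs; first by move=> z zs; apply: sF;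
    rewrite /= inE zs orbT.
  have [|Z FZ Zy] := sF y; first by rewrite /= mem_head.
  have [YZ|ZY] := totF _ _ FY FZ.
  - exists Z => // z /=; rewrite inE => /orP[/eqP->//|zs]; exact/YZ/sY.
  - exists Y => // z /=; rewrite inE => /orP[/eqP->|zs]; [exact: ZY|exact: sY].
exists A; split=> // x CxA; apply: contrapT => nAx; apply: Amax CxA.
by split=> [y Ay|/(_ x (or_introl erefl))]; [right|].
Qed.

(** Being pairwise related is a property of finite character, so a maximal set
    exists; both antichains and sparse sets are obtained in this way. *)
Lemma pairwise_maximal T (S : set T) (r : T -> T -> Prop) :
  exists A, [/\ A `<=` S, forall x y, A x -> A y -> x <> y -> r x y
    & forall x, S x -> (forall y, A y -> x <> y -> r x y /\ r y x) -> A x].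
Proof.
pose C A := A `<=` S /\ forall x y, A x -> A y -> x <> y -> r x y.
have [|A|A [[AS rA] Amax]] := @finite_character_maximal T C.
- by split.
- split=> [[AS rA] F _ FA|Cf].
    split=> [x /FA/AS//|x y /FA Ax /FA Ay]; exact: rA.
  split=> [x Ax|x y Ax Ay].
    have [|y ->|+ _] := Cf [set x]; [exact: finite_set1|by []|exact].
  have [||_] := Cf ([set x] `|` [set y]).
  - by rewrite finite_setU.
  - by move=> z [->|->].
  - by apply; [left|right].
- exists A; split=> // x Sx rx; apply: Amax; split=> [y [->//|/AS//]|].
  move=> y z [->|Ay] [->|Az] // yz; [exact: (rx z Az yz).1| |exact: rA].
  by apply: (rx y Ay _).2 => e; apply: yz.
Qed.

(** * Well-orders of type [omega_1] as total orders *)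

Lemma well_order_anti T (R : rel T) : well_order R -> antisymmetric R.
Proof.
move=> wR x y; apply: (@wo_chain_antisymmetric {classic T} R predT) => //.
by move=> A _; exact: wR.
Qed.

Lemma well_order_total T (R : rel T) : well_order R -> total R.
Proof.
move=> wR x y; apply: (@wo_chainW {classic T} R predT) => //.
by move=> A _; exact: wR.
Qed.

Lemma well_order_trans T (R : rel T) : well_order R -> transitive R.
Proof.
move=> wR y x z Rxy Ryz; have Ranti := well_order_anti wR.
(* Compare [x], [y] and [z] with the least of them. *)
have [|w [[/asboolP we lw] _]] :=
    wR (fun t => `[< [\/ t = x, t = y | t = z] >]).
  by exists x; apply/asboolP; apply: Or31.
have xw : R w x by apply: lw; apply/asboolP; apply: Or31.
have yw : R w y by apply: lw; apply/asboolP; apply: Or32.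
have zw : R w z by apply: lw; apply/asboolP; apply: Or33.
case: we => we; subst w => //.
  by rewrite (Ranti x y) ?Rxy.
by rewrite -(Ranti y z) ?Ryz.
Qed.

(** A copy of [W] that carries [R] as its canonical order. *)
Definition omega1_carrier W (R : rel W) (_ : omega1_order R) : Type := W.

Section OrderOfOmega1.
Context (W : Type) (R : rel W) (RW : omega1_order R).

Local Notation T := (omega1_carrier RW).

HB.instance Definition _ := Choice.copy T {classic W}.

Let wR : well_order R. Proof. by have [] := RW. Qed.
Let reflR : reflexive (R : rel T).
Proof. by move=> x; rewrite -[R x x]orbb well_order_total. Qed.

HB.instance Definition _ := Order.Le_isPOrder.Build (Order.Disp tt tt) T reflR
  (well_order_anti wR) (well_order_trans wR).
HB.instance Definition _ :=
  Order.POrder_isTotal.Build (Order.Disp tt tt) T (well_order_total wR).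

Lemma omega1_carrierP : omega1_order (<=%O : rel T).
Proof. exact: RW. Qed.

End OrderOfOmega1.

(** * Stationary sets and Fodor's lemma *)

Section Large.
Context (dW : Order.disp_t) (W : orderType dW).
Hypothesis omegaW : omega1_order (<=%O : rel W).
Implicit Types (S A : set W) (v w x y : W).

Lemma omega1_minimum A : A !=set0 -> exists2 m, A m & lbound A m.
Proof.
have [wR _ _] := omegaW; move=> [x Ax].
have [|m [[Am lm] _]] := wR (fun t => `[< A t >]).
  by exists x; apply/asboolP.
by exists m => [|y Ay]; [exact/asboolP|apply: lm; exact/asboolP].
Qed.

Lemma omega1_segment w : countable [set v | v <= w].
Proof. by have [_ _] := omegaW. Qed.

Lemma omega1_uncountable : ~ countable [set: W].
Proof. by have [] := omegaW. Qed.

Lemma omega1_ind (P : W -> Prop) :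
  (forall w, (forall v, v < w -> P v) -> P w) -> forall w, P w.
Proof.
move=> Pind w; apply: contrapT => nPw.
have [|m nPm lm] := @omega1_minimum [set v | ~ P v]; first by exists w.
apply: nPm; apply: Pind => v vm; apply: contrapT => nPv.
by have := lm v nPv; rewrite leNgt vm.
Qed.

Lemma countable_bounded A : countable A -> exists b, forall x, A x -> x < b.
Proof.
move=> cA; apply: contrapT => /forallNP unb; apply: omega1_uncountable.
apply: (@sub_countable_set _ _ (\bigcup_(x in A) [set v | v <= x])).
  move=> b _; have /existsNP[x /not_implyP[Ax /negP]] := unb b.
  by rewrite -leNgt => bx; exists x.
by apply: bigcup_countable => // x _; exact: omega1_segment.
Qed.

Lemma omega1_least : exists m : W, forall x, m <= x.
Proof.
have [|m _ mmin] := @omega1_minimum [set: W].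
  by have [w _] := countable_bounded (countable0 W); exists w.
by exists m => x; exact: mmin.
Qed.

Lemma uncountable_above S b : ~ countable S -> exists2 x, S x & b < x.
Proof.
move=> uS; apply: contrapT => no; apply: uS.
apply: sub_countable_set (omega1_segment b) => x Sx /=.
by rewrite leNgt; apply/negP => bx; apply: no; exists x.
Qed.

(** The nonstationary sets, without clubs: [S] is nonstationary iff it carries
    a regressive function tending to [omega_1]. Countably many exceptions are
    allowed for each bound, so that countable sets are covered too. *)
Definition small S := exists h : W -> W,
  forall b, countable [set x | S x /\ ~ (b < h x < x)].

Definition large S := ~ small S.

Lemma sub_small S S' : S `<=` S' -> small S' -> small S.
Proof.
move=> SS [h hP]; exists h => b; apply: sub_countable_set (hP b) => x [Sx nb].
by split=> //; exact: SS.
Qed.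

Lemma small_countable S : countable S -> small S.
Proof.
by move=> cS; exists id => b; apply: sub_countable_set cS => x [].
Qed.

(** Use on each point the regressive function of one set that contains it. *)
Lemma small_bigcup (F : nat -> set W) :
  (forall n, small (F n)) -> small (\bigcup_n F n).
Proof.
move=> /choice[h hP].
have /choice[n nP] (x : W) : exists n, (\bigcup_n F n) x -> F n x.
  by have [[n _ Fx]|nF] := pselect ((\bigcup_n F n) x); [exists n|exists 0].
exists (fun x => h (n x) x) => b.
apply: (@sub_countable_set _ _
  (\bigcup_n [set x | F n x /\ ~ (b < h n x < x)])).
  by move=> x [Fx nb]; exists (n x) => //; split=> //; exact: nP.
by apply: bigcup_countable => // m _; exact: hP.
Qed.

(** A function as in the definition of [small] on the whole of [omega_1] fails
    at a closure point: if every exception for a bound below [c] lies below [c],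
    then [h c] exceeds every bound below [c], yet [h c < c]. *)
Lemma large_setT : large [set: W].
Proof.
move=> [h hP].
have /choice[next nextP] b : exists c, b < c /\
    forall x, ~ (b < h x < x) -> x < c.
  have [c cP] := countable_bounded (hP b).
  have [c' bc'] := countable_bounded (omega1_segment b).
  exists (Order.max c c').
  rewrite lt_max (bc' b (lexx b)) orbT; split=> // x nx.
  by rewrite lt_max cP.
have [x0 _] := omega1_least.
pose s n := iter n next x0.
have [|c sc cmin] := @omega1_minimum [set c | forall n, s n < c].
  have [|c cP] := @countable_bounded (range s); first exact: countable_image.
  by exists c => n; exact/cP/imageT.
have sh n : s n < h c < c.
  apply: contrapT => /(nextP (s n)).2; rewrite -[next _]/(s n.+1).
  by rewrite ltNge ltW.
have [n hn] : exists n, h c <= s n.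
  apply: contrapT => /forallNP no.
  have /cmin : forall n, s n < h c by move=> n; rewrite ltNge; exact/negP.
  by rewrite leNgt; have /andP[_ ->] := sh 0.
by have /andP[] := sh n; rewrite ltNge hn.
Qed.

Lemma sub_large S S' : S `<=` S' -> large S -> large S'.
Proof. by move=> /sub_small sS lS /sS. Qed.

Lemma large_uncountable S : large S -> ~ countable S.
Proof. by move=> lS /small_countable. Qed.

Lemma large_cover S (F : nat -> set W) :
  large S -> S `<=` \bigcup_n F n -> exists n, large (S `&` F n).
Proof.
move=> lS SF; apply: contrapT => /forallNP no; apply: lS.
apply: (@sub_small _ (\bigcup_n (S `&` F n))) => [x Sx|].
  by have [n _ Fx] := SF x Sx; exists n.
by apply: small_bigcup => n; exact: contrapT (no n).
Qed.

Lemma large_fiber (C : countType) S (f : W -> C) :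
  large S -> exists c, large (S `&` [set x | f x = c]).
Proof.
move=> lS; pose F n := [set x | choice.pickle (f x) = n].
have [|n lSn] := @large_cover S F lS.
  by move=> x _; exists (choice.pickle (f x)).
have [x [Sx fx]] : S `&` F n !=set0.
  apply: contrapT => S0; apply: lSn; apply: small_countable.
  by apply: sub_countable_set (countable0 _) => x Sx; case: S0; exists x.
exists (f x); apply: sub_large lSn => y [Sy fy]; split=> //.
by apply: (pcan_inj choice.pickleK); rewrite fx fy.
Qed.

Lemma large_setD_countable S A : large S -> countable A -> large (S `\` A).
Proof.
move=> lS cA sSA; apply: lS.
apply: (@sub_small _ (\bigcup_n (if n == 0 then A else S `\` A))) => [x Sx|].
  by have [Ax|nAx] := pselect (A x); [exists 0|exists 1].
by apply: small_bigcup => -[|n] //=; exact: small_countable.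
Qed.

(** If every fiber of [h] were nonstationary, with witnesses [g v], then the
    maximum of [h x] and [g (h x) x] would witness that [S] is. *)
Lemma fodor S (h : W -> W) : large S -> (forall x, S x -> h x < x) ->
  exists v, large (S `&` [set x | h x = v]).
Proof.
move=> lS hS; apply: contrapT => /forallNP no; apply: lS.
have /choice[g gP] v := contrapT (no v).
(* [g (h x) x] may fail to be below [x] at countably many points of each fiber,
   hence possibly at uncountably many points in all; [h x] replaces it there. *)
exists (fun x =>
  if g (h x) x < x then Order.max (h x) (g (h x) x) else h x) => b.
apply: (@sub_countable_set _ _ (\bigcup_(v in [set v | v <= b])
  [set x | (S `&` [set x | h x = v]) x /\ ~ (b < g v x < x)])).
  move=> x [Sx nb]; have [hb|bh] := leP (h x) b; last first.
    by case: nb; case: ifP => [gx|_]; rewrite ?gt_max ?lt_max ?bh ?hS ?gx.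
  exists (h x) => //; split=> // /andP[bg gx]; apply: nb.
  by rewrite gx lt_max gt_max bg gx hS ?orbT.
by apply: bigcup_countable => [|v _]; [exact: omega1_segment|exact: gP].
Qed.

(** Fodor's lemma for the maximum of the part of [F x] below [x]. *)
Lemma fodor_finite S (F : W -> set W) :
  large S -> (forall x, finite_set (F x)) ->
  exists b, large (S `&` [set x | forall v, F x v -> v < x -> v <= b]).
Proof.
move=> lS finF.
have [m mmin] := omega1_least.
(* [m] stands for the maximum when [F x] has no member below [x]. *)
have /choice[h hP] x : exists y, (m < x -> y < x) /\
    forall v, F x v -> v < x -> v <= y.
  have [s Fs] := (finite_seqP _).1 (finF x).
  suff [y [yx yP]] : exists y, (m < x -> y < x) /\
      forall v, v \in s -> v < x -> v <= y.
    by exists y; split=> // v Fv; apply: yP; move: Fv; rewrite Fs.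
  elim: s {Fs} => [|w s [y [yx yP]]]; first by exists m.
  have [wx|xw] := ltP w x.
    exists (Order.max w y); split=> [/yx|v]; first by rewrite gt_max wx.
    by rewrite inE le_max => /orP[/eqP->|/yP yv /yv->]; rewrite ?lexx ?orbT.
  exists y; split=> // v; rewrite inE => /orP[/eqP->|]; last exact: yP.
  by rewrite ltNge xw.
have lS' := large_setD_countable lS (finite_set_countable (finite_set1 m)).
have [|b lb] := @fodor _ h lS'.
  by move=> x [_ xm]; apply: (hP x).1; rewrite lt_neqAle eq_sym; apply/andP;
    split; [exact/eqP|exact: mmin].
exists b; apply: sub_large lb => x [[Sx _] <-]; split=> // v.
exact: (hP x).2.
Qed.

(** A maximal sparse subset of [S] is uncountable: otherwise a member of [S]
    far above it could be added. *)
Lemma sparse_uncountable S (b : W -> W) : ~ countable S ->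
  exists S', [/\ S' `<=` S, ~ countable S'
    & forall x y, S' x -> S' y -> x < y -> b x < y].
Proof.
move=> uS.
have [A [AS rA Amax]] := @pairwise_maximal W S (fun x y => x < y -> b x < y).
exists A; split=> // [cA|x y Ax Ay xy]; last first.
  by apply: rA => // e; move: xy; rewrite e ltxx.
have [c Ac] := countable_bounded cA.
have [c' bAc] := countable_bounded (countable_image b cA).
have [x Sx cx] := uncountable_above (Order.max c c') uS.
move: cx; rewrite gt_max => /andP[cx cx'].
have Ax : A x.
  apply: Amax => // y Ay _; split=> [xy|_].
    by have := lt_trans xy (lt_trans (Ac _ Ay) cx); rewrite ltxx.
  by apply: lt_trans cx'; exact/bAc/imageP.
by have := Ac x Ax; rewrite ltNge ltW.
Qed.

(** * Ladders and an [omega_1]-sequence of reals *)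

Lemma segment_enumeration : exists f : W -> nat -> W,
  forall w v, v <= w <-> exists n, f w n = v.
Proof.
suff /choice[f fP] : forall w, exists e : nat -> W,
    forall v, v <= w <-> exists n, e n = v by exists f.
move=> w.
have [|f fP] := countable_range (omega1_segment w); first by exists w => /=.
exists f => v; split=> [vw|[n <-]].
  by have [n _ <-] : range f v; [rewrite -fP|exists n].
by suff : [set v | v <= w] (f n) by []; rewrite fP; exact: imageT.
Qed.

(** At successors the ladder is eventually constant with value the predecessor,
    and the least ordinal, which has nothing below it, is its own ladder. *)
Lemma ladder_system : exists eta : W -> nat -> W,
  [/\ forall w k, eta w k <= w,
      forall v w k, v < w -> eta w k < w
    & forall v w, v < w -> exists K, forall k, (K <= k)%N -> v <= eta w k].
Proof.
suff /choice[eta etaP] : forall w, exists e : nat -> W,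
  [/\ forall k, e k <= w, forall v k, v < w -> e k < w
    & forall v, v < w -> exists K, forall k, (K <= k)%N -> v <= e k].
  by exists eta; split=> [w k|v w k|v w]; have [e1 e2 e3] := etaP w;
    [exact: e1|exact: e2|exact: e3].
move=> w; have [[v0 v0w]|no] := pselect (exists v, v < w); last first.
  by exists (fun=> w); split=> [k|v k vw|v vw] //; case: no; exists v.
have [||f fP] := @countable_range W [set v | v < w].
- by apply: sub_countable_set (omega1_segment w) => v /ltW.
- by exists v0.
have fw n : f n < w.
  by suff : [set v | v < w] (f n) by []; rewrite fP; exact: imageT.
pose e := fix e k := if k is k'.+1 then Order.max (e k') (f k) else f 0.
have ew k : e k < w by elim: k => [|k IHk] /=; rewrite ?gt_max ?IHk fw.
have fe k : f k <= e k by case: k => [|k] //=; rewrite le_max lexx orbT.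
have em n k : (n <= k)%N -> e n <= e k.
  elim: k => [|k IHk]; first by rewrite leqn0 => /eqP->.
  by rewrite leq_eqVlt => /orP[/eqP->//|/IHk nk] /=; rewrite le_max nk.
exists e; split=> [k|//|v vw]; first exact: ltW.
have [n _ fn] : range f v by rewrite -fP.
by exists n => k /em; apply: le_trans; rewrite -fn.
Qed.

(** Diagonalize: [u w] differs from [u v] at the place that an enumeration of
    the segment of [w] assigns to [v < w]. *)
Lemma omega1_reals : exists u : W -> nat -> bool, injective u.
Proof.
have [f fP] := segment_enumeration.
have wf : well_founded (fun v w => v < w).
  by apply: omega1_ind => w IHw; constructor.
pose u := Fix wf (fun=> nat -> bool) (fun w rec n =>
  if @idP (f w n < w) is ReflectT lt_w then ~~ rec (f w n) lt_w n else true).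
have uE w n : f w n < w -> u w n = ~~ u (f w n) n.
  move=> fw; rewrite {1}/u Fix_eq.
    by case: {-}_ / idP => // fw'; rewrite -/(u _).
  move=> x g1 g2 g12; apply: funext => k.
  by case: {-}_ / idP => // ?; rewrite g12.
have uneq v w : v < w -> u v <> u w.
  move=> vw e; have [n fn] := (fP w v).1 (ltW vw).
  have := uE w n; rewrite fn => /(_ vw); rewrite e.
  by case: (u w n).
exists u => v w uvw; apply/eqP; rewrite eq_le !leNgt.
by apply/andP; split; apply/negP => /uneq; apply; rewrite uvw.
Qed.

End Large.
(** * Filtrations and finite sets *)

(** Ordering [T] first by the level at which a point appears, then by any
    well-order, gives order type [omega_1]. *)
Lemma card_omega1_filtration (dW : Order.disp_t) (W : orderType dW)
    (T : Type) (L : W -> set T) :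
    omega1_order (<=%O : rel W) ->
    (forall v w, v <= w -> L v `<=` L w) -> (forall w, countable (L w)) ->
    (forall x, exists w, L w x) -> ~ countable [set: T] ->
  card_omega1 [set: T].
Proof.
move=> omegaW Lmono Lc Lex uT.
have /choice[r rP] x : exists w, L w x /\ forall v, L v x -> w <= v.
  by have [w Lw wmin] := omega1_minimum omegaW (Lex x); exists w.
have [R0 wR0] := well_ordering_principle {classic T}.
pose R (x y : {classic T}) := (r x < r y) || ((r x == r y) && R0 x y).
exists T, R; split; last exact: card_eqxx.
split=> // [|y]; last first.
  apply: sub_countable_set (Lc (r y)) => x /orP[xy|/andP[/eqP <- _]].
    by apply: Lmono (ltW xy) _ _; exact: (rP x).1.
  exact: (rP x).1.
apply: antisymmetric_well_order => [x y|A [x Ax]].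
  rewrite /R; have [//|//|/= exy] := ltgtP (r x) (r y).
  exact: well_order_anti.
have [|_ [z Az <-] zmin] := @omega1_minimum _ _ omegaW (r @` [set t | t \in A]).
  by exists (r x), x.
have [|m [[/andP[Am /eqP rm] lm] _]] :=
    wR0 (fun t => (t \in A) && (r t == r z)).
  by exists z; apply/andP; split.
exists m; split=> // y Ay; rewrite /R rm; have := zmin (r y) (imageP r Ay).
rewrite le_eqVlt => /orP[/eqP e|->//].
by rewrite e ltxx eqxx /=; apply: lm; apply/andP; split=> //; apply/eqP.
Qed.

Lemma countable_preimage_inj T U (f : T -> U) (B : set U) :
  injective f -> countable B -> countable (f @^-1` B).
Proof.
move=> finj /countable_injP[g ginj]; apply/countable_injP; exists (g \o f).
move=> x y; rewrite !inE => Bx By /= e; apply: finj; apply: ginj => //;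
  by rewrite inE.
Qed.

Lemma finite_sub_image T U (f : T -> U) (A : set T) (F : set U) :
  finite_set F -> F `<=` f @` A ->
  exists G, [/\ finite_set G, G `<=` A & F = f @` G].
Proof.
elim/Pchoice: U => U in f F * => /finite_seqP[s ->].
elim: s => [|y s IHs] sfA.
  by exists set0; rewrite image_set0; split=> //; apply/seteqP; split.
have [x Ax fx] := sfA y (mem_head y s).
have [z zs|G [finG GA sG]] := IHs; first by apply: sfA; rewrite /= inE zs orbT.
exists (x |` G); split=> [|z [->//|/GA//]|].
  by rewrite finite_setU; split=> //; exact: finite_set1.
apply/seteqP; split=> [z|_ [w [->|Gw] <-]] /=.
- rewrite inE => /orP[/eqP->|zs]; first by exists x => //; left.
  by have : [set` s] z by []; rewrite sG => -[w Gw <-]; exists w => //; right.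
- by rewrite fx mem_head.
- rewrite inE; apply/orP; right.
  by suff : [set` s] (f w) by []; rewrite sG; exact: imageP.
Qed.

Lemma finite_nat_bound T (F : set T) (Q : T -> nat -> Prop) : finite_set F ->
    (forall x, F x -> exists N, forall k, (N <= k)%N -> Q x k) ->
  exists N, forall x k, F x -> (N <= k)%N -> Q x k.
Proof.
elim/Pchoice: T => T in F Q * => /finite_seqP[s ->].
elim: s => [|x s IHs] sQ; first by exists 0.
have [N xN] := sQ x (mem_head x s).
have [y ys|M sM] := IHs; first by apply: sQ; rewrite /= inE ys orbT.
exists (maxn N M) => y k /=.
rewrite inE geq_max => /orP[/eqP->|ys] /andP[Nk Mk].
  exact: xN.
exact: sM.
Qed.

(** * Posets with precaliber [omega_1] *)

Section Posets.
Context (d : Order.disp_t) (P : porderType d).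
Hypothesis precP : precaliber_omega1 P.
Implicit Types (p q : P) (D : set P).

(** A family with uncountably many values contains a centered one by precaliber;
    otherwise some value is repeated uncountably often. *)
Lemma precaliber_family T (S : set T) (f : T -> P) : ~ countable S ->
  exists S', [/\ S' `<=` S, ~ countable S' & centered (f @` S')].
Proof.
move=> uS; have [cfS|ufS] := pselect (countable (f @` S)).
  have [p uSp] : exists p, ~ countable [set x | S x /\ f x = p].
    apply: contrapT => /forallNP no; apply: uS.
    apply: (@sub_countable_set _ _
        (\bigcup_(p in f @` S) [set x | S x /\ f x = p])).
      by move=> x Sx; exists (f x); [exact: imageP|].
    by apply: bigcup_countable => // p _; exact: contrapT (no p).
  exists [set x | S x /\ f x = p]; split=> // [x []//|F _ FS].
  by exists p => q /FS[x [_ <-] <-].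
have [Y [YfS uY centY]] := precP ufS.
exists (S `&` f @^-1` Y); split=> [x []//|cS|F finF FS].
  apply: uY; apply: sub_countable_set (countable_image f cS) => y Yy.
  by have [x Sx fx] := YfS y Yy; exists x => //; split=> //; rewrite /= fx.
by apply: centY => // q /FS[x [_ Yfx] <-].
Qed.

Definition lower_bound_closed (P0 : set P) :=
  forall F, finite_set F -> F `<=` P0 -> lbound F !=set0 ->
  exists2 q, P0 q & lbound F q.

Definition predense_in (P0 : set P) (e : nat -> P) := (forall n, P0 (e n)) /\
  forall p, P0 p -> exists q, [/\ P0 q, q <= p & exists n, q <= e n].

(** A maximal antichain of [D] in [P0] is predense, and it is countable since a
    centered set contains no two incompatible elements. *)
Lemma countable_predense (P0 : set P) D : P0 !=set0 -> lower_bound_closed P0 ->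
    (forall p, P0 p -> exists q, [/\ P0 q, D q & q <= p]) ->
  exists e, predense_in P0 e /\ forall n, D (e n).
Proof.
move=> [p0 P0p0] closedP0 denseD.
pose incompatible p q := ~ (lbound [set p; q] !=set0).
have [A [AD incA maxA]] := pairwise_maximal (P0 `&` D) incompatible.
have cA : countable A.
  apply: contrapT => /precP[Y [YA uY centY]].
  have [x Yx] : Y !=set0.
    apply: contrapT => Y0; apply: uY.
    by apply: sub_countable_set (countable0 P) => x Yx; case: Y0; exists x.
  have [y [Yy xy]] : exists y, Y y /\ x <> y.
    apply: contrapT => no; apply: uY.
    apply: sub_countable_set (finite_set_countable (finite_set1 x)) => y Yy /=.
    by apply: contrapT => yx; apply: no; exists y; split=> // /esym.
  apply: (incA x y (YA _ Yx) (YA _ Yy) xy); apply: centY.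
    by rewrite finite_setU; split; exact: finite_set1.
  by move=> z [->|->].
have extA q : P0 q -> D q -> exists a, A a /\ lbound [set q; a] !=set0.
  move=> P0q Dq; have [Aq|nAq] := pselect (A q).
    by exists q; split=> //; exists q => z [->|->].
  apply: contrapT => /forallNP no; apply: nAq; apply: maxA => // a Aa _.
  by split=> qa; apply: (no a); split=> //; rewrite setUC.
have [|e Ae] := countable_range cA.
  have [q [P0q Dq _]] := denseD _ P0p0.
  by have [a [Aa _]] := extA q P0q Dq; exists a.
have AeP n : A (e n) by rewrite Ae; exact: imageT.
exists e; split=> [|n]; last exact: (AD _ (AeP n)).2.
split=> [n|p P0p]; first exact: (AD _ (AeP n)).1.
have [q [P0q Dq qp]] := denseD p P0p.
have [a [Aa qa]] := extA q P0q Dq.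
have [|z [->//|->]|r P0r lr] := closedP0 [set q; a] _ _ qa.
- by rewrite finite_setU; split; exact: finite_set1.
- exact: (AD _ Aa).1.
exists r; split=> //; first by apply: le_trans qp; apply: lr; left.
by move: Aa lr; rewrite Ae => -[n _ <-] lr; exists n; apply: lr; right.
Qed.

Lemma meet_finitely_many (P0 : set P) (s : seq (nat -> P)) p : P0 p ->
    (forall e, e \in s -> predense_in P0 e) ->
  exists q, [/\ P0 q, q <= p & forall e, e \in s -> exists n, q <= e n].
Proof.
move=> P0p; elim: s => [|e s IHs] es; first by exists p.
have [f fs|q [P0q qp qs]] := IHs; first by apply: es; rewrite inE fs orbT.
have [r [P0r rq [n rn]]] := (es e (mem_head e s)).2 q P0q.
exists r; split=> //; first exact: le_trans qp.
move=> f; rewrite inE => /orP[/eqP->|/qs[m qm]]; first by exists n.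
by exists m; exact: le_trans qm.
Qed.

End Posets.

(** * The auxiliary poset *)

Section Conditions.
Context (d : Order.disp_t) (P : porderType d) (P0 : set P).
Context (W : Type) (eta : W -> nat -> W) (u : W -> nat -> bool)
  (idx : W -> nat -> nat -> P).

Definition agree (n : nat) (x y : W) := forall m, (m < n)%N -> u x m = u y m.

(** Distinct reals agree only up to a finite stage, so two ordinals of [G] that
    share their [k]-th ladder point leave finitely many terms of [idx x k] below
    which [p] may lie. *)
Definition tied (p : P) (G : set W) := forall x y k,
  G x -> G y -> x <> y -> eta x k = eta y k ->
  exists n, agree n x y /\ p <= idx x k n.

Record condition := Condition {
  stem : P;
  side : set W;
  conditionP : [/\ P0 stem, finite_set side & tied stem side] }.

HB.instance Definition _ := Choice.copy condition {classic condition}.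

Definition condition_le (c c' : condition) :=
  (stem c <= stem c') && `[< side c' `<=` side c >].

Lemma condition_leP c c' :
  reflect (stem c <= stem c' /\ side c' `<=` side c) (condition_le c c').
Proof. by apply: (iffP andP) => -[p /asboolP G]. Qed.

Lemma condition_le_refl : reflexive condition_le.
Proof. by move=> c; apply/condition_leP; split. Qed.

Lemma condition_eq c c' : stem c = stem c' -> side c = side c' -> c = c'.
Proof.
case: c c' => [p G h] [p' G' h'] /= e e'; case: _ / e in h' *.
by case: _ / e' in h' *; rewrite (Prop_irrelevance h h').
Qed.

Lemma condition_le_anti : antisymmetric condition_le.
Proof.
move=> c c' /andP[/condition_leP[p G] /condition_leP[p' G']].
by apply: condition_eq; [apply/eqP; rewrite eq_le p p'|exact/seteqP].
Qed.

Lemma condition_le_trans : transitive condition_le.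
Proof.
move=> b a c /condition_leP[p G] /condition_leP[p' G']; apply/condition_leP.
by split; [exact: le_trans p'|exact: subset_trans G].
Qed.

HB.instance Definition _ := Order.Le_isPOrder.Build (Order.Disp tt tt) condition
  condition_le_refl condition_le_anti condition_le_trans.

Lemma tied_set1 p x : tied p [set x].
Proof. by move=> y z k -> -> /(_ erefl). Qed.

Lemma agree_trans n x y z : agree n x y -> agree n y z -> agree n x z.
Proof. by move=> xy yz m mn; rewrite xy// yz. Qed.

Lemma agree_leq m n x y : (m <= n)%N -> agree n x y -> agree m x y.
Proof. by move=> mn xy k km; apply: xy; exact: leq_trans mn. Qed.

End Conditions.

(** * Precaliber of the auxiliary poset *)

Section Core.
Context (d : Order.disp_t) (P : porderType d) (P0 : set P).
Context (dW : Order.disp_t) (W : orderType dW).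
Context (eta : W -> nat -> W) (u : W -> nat -> bool).
Context (idx : W -> nat -> nat -> P).
Context (L : W -> set P).
Hypothesis precP : precaliber_omega1 P.
Hypothesis closedP0 : lower_bound_closed P0.
Hypothesis omegaW : omega1_order (<=%O : rel W).
Hypothesis etaW : forall w k, eta w k <= w.
Hypothesis etaS : forall v w k, v < w -> eta w k < w.
Hypothesis eta_cofinal :
  forall v w, v < w -> exists K, forall k, (K <= k)%N -> v <= eta w k.
Hypothesis uinj : injective u.
Hypothesis idxP : forall w k, predense_in P0 (idx w k).
Hypothesis Lmono : forall v w, v <= w -> L v `<=` L w.
Hypothesis Lcount : forall w, countable (L w).
Hypothesis Lex : forall p, P0 p -> exists w, L w p.

Local Notation condition := (condition P0 eta u idx).
Local Notation tied := (tied eta u idx).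
Local Notation agree := (agree u).

(** These countable levels show that the poset has size at most [omega_1], and
    are used to pick conditions far out in an uncountable set. *)
Definition condition_level (w : W) : set condition :=
  [set c | L w (stem c) /\ side c `<=` [set v | v <= w]].

Lemma condition_level_mono v w :
  v <= w -> condition_level v `<=` condition_level w.
Proof.
move=> vw c [Lc cv]; split=> [|x /cv xv]; first exact: Lmono vw _ Lc.
exact: le_trans vw.
Qed.

Lemma condition_level_ex c : exists w, condition_level w c.
Proof.
have [P0c finc _] := conditionP c.
have [v Lv] := Lex P0c.
have [w cw] := countable_bounded omegaW (finite_set_countable finc).
exists (Order.max v w); split=> [|x /cw /ltW xw /=]; last first.
  by rewrite le_max xw orbT.
by apply: Lmono Lv; rewrite le_max lexx.
Qed.

Lemma condition_level_countable w : countable (condition_level w).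
Proof.
pose f (c : condition) := (stem c, side c).
have finj : injective f by move=> c c' [? ?]; exact: condition_eq.
have cL := countableX (Lcount w)
  (countable_finite_subset (omega1_segment omegaW w)).
apply: sub_countable_set (countable_preimage_inj finj cL) => c [Lc cw].
by have [_ finc _] := conditionP c.
Qed.

(** The outcome of thinning an uncountable set of conditions to a family [c w],
    [w] in [T]. The ordinals in [side (c w)] are either at most [B] or above
    [w], and the ladders of the latter stay at or above [w] from the index [N]
    on. The stem of [c w] is extended to [p w], which lies below a term of [idx v k]
    for [v] in the side and [k < N]; [l w v k] is the least index of such a
    term, and [M w] bounds these indices. The map [g] codes the ordinals up to
    [B] by integers. *)
Section Thinning.
Context (c : W -> condition) (p : W -> P) (B : W) (N : nat) (M : W -> nat)
  (l : W -> W -> nat -> nat) (g : W -> nat) (T : set W).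
Hypothesis sideB : forall w v, side (c w) v -> v <= B \/ w < v.
Hypothesis pc : forall w, p w <= stem (c w).
Hypothesis etaN :
  forall w v k, T w -> side (c w) v -> w < v -> (N <= k)%N -> w <= eta v k.
Hypothesis l_met :
  forall w v k, side (c w) v -> (k < N)%N -> p w <= idx v k (l w v k).
Hypothesis l_least : forall w v k n, p w <= idx v k n -> (l w v k <= n)%N.
Hypothesis lM :
  forall w v k, side (c w) v -> (k < N)%N -> (l w v k <= M w)%N.
Hypothesis ginj : {in [set v | v <= B] &, injective g}.

Let code v := if v <= B then Some (g v) else None.

Let codeP v v' : v <= B -> code v' = code v -> v' = v.
Proof.
rewrite /code => vB; rewrite vB; case: ifP => // v'B [].
by apply: ginj; rewrite inE.
Qed.

(** All that has to be known about [v] in [side (c w)] to amalgamate [c w] with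
    the other conditions; there are countably many profiles, hence the list of
    those that occur can be made independent of [w]. *)
Definition profile (w v : W) : option nat * seq (nat * option nat) * seq bool :=
  (code v, [seq (l w v k, code (eta v k)) | k <- iota 0 N],
   [seq u v m | m <- iota 0 (M w)]).

(** Consider [x] in [side (c w)] and [y] in [side (c w')] with a common [k]-th
    ladder point. If [x] or [y] is at most [B], its profile puts it in both
    sides. Otherwise sparseness forces [k < N] and the common ladder point to be
    at most [B]. Then some [z] in [side (c w)] has the profile of [y], hence the
    same ladder point; [c w] is a condition, so [u x] and [u z] agree below
    [l w x k], and [u z] and [u y] agree by their profiles. *)
Lemma thin_tied q (G : set W) :
    finite_set G -> G `<=` T -> (forall w, G w -> q <= p w) ->
    (forall w w' v, T w -> T w' -> w < w' -> side (c w) v -> v < w') ->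
    (forall w, T w -> B < w) ->
    (forall w v k, T w -> side (c w) v -> (k < N)%N -> eta v k < w ->
       eta v k <= B) ->
    (forall w w' v, T w -> T w' -> side (c w) v ->
       exists2 v', side (c w') v' & profile w' v' = profile w v) ->
    (forall w w', T w -> T w' -> M w = M w') ->
  tied q (\bigcup_(w in G) side (c w)).
Proof.
move=> finG GT qp sparse BT etaB transfer MT.
move=> x y k [w Gw wx] [w' Gw' w'y] xy exy.
have together v : G v -> side (c v) x -> side (c v) y ->
    exists n, agree n x y /\ q <= idx x k n.
  move=> Gv vx vy.
  have [_ _ /(_ x y k vx vy xy exy)[n [a sn]]] := conditionP (c v).
  exists n; split=> //; apply: le_trans sn.
  exact: le_trans (qp v Gv) (pc v).
have [Tw Tw'] := (GT _ Gw, GT _ Gw').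
have [xB|Bx] := leP x B.
  have [x' w'x' [ex _ _]] := transfer w w' x Tw Tw' wx.
  by apply: (together w') => //; rewrite -(codeP xB ex).
have [yB|By] := leP y B.
  have [y' wy' [ey _ _]] := transfer w' w y Tw' Tw w'y.
  by apply: (together w) => //; rewrite -(codeP yB ey).
have wltx : w < x by case: (sideB wx) => //; rewrite leNgt Bx.
have wlty : w' < y by case: (sideB w'y) => //; rewrite leNgt By.
have [eww'|neww'] := eqVneq w w'.
  by apply: (together w) => //; rewrite eww'.
have [kN exB] : (k < N)%N /\ eta x k <= B.
  have [ww'|w'w|e] := ltgtP w w'; last by rewrite e eqxx in neww'.
  - have xw := sparse _ _ _ Tw Tw' ww' wx.
    have eyw : eta y k < w' by rewrite -exy; exact: le_lt_trans xw.
    have kN : (k < N)%N.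
      by rewrite ltnNge; apply/negP => /(etaN Tw' w'y wlty); rewrite leNgt eyw.
    by split=> //; rewrite exy; exact: etaB eyw.
  - have yw := sparse _ _ _ Tw' Tw w'w w'y.
    have exw : eta x k < w by rewrite exy; exact: le_lt_trans yw.
    have kN : (k < N)%N.
      by rewrite ltnNge; apply/negP => /(etaN Tw wx wltx); rewrite leNgt exw.
    by split=> //; exact: etaB exw.
have [z wz [_ /eq_in_map ez uz]] := transfer w' w y Tw' Tw w'y.
move: uz; rewrite (MT _ _ Tw' Tw) => /eq_in_map uz.
have ezx : eta x k = eta z k.
  have kin : k \in iota 0 N by rewrite mem_iota.
  have [_ ez'] := ez k kin.
  by rewrite exy; apply/esym/codeP; [rewrite -exy|].
exists (l w x k); split; last exact: le_trans (qp w Gw) (l_met wx kN).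
apply: (@agree_trans _ _ _ _ z).
  have [->//|/eqP xz] := eqVneq x z.
  have [_ _ /(_ x z k wx wz xz ezx)[n [a sn]]] := conditionP (c w).
  by apply: agree_leq a; apply: l_least; exact: le_trans sn.
apply: (agree_leq (n := M w)); first exact: lM.
by move=> m mM; apply: uz; rewrite mem_iota.
Qed.

End Thinning.

(** The thinning: pick conditions [a w] outside the [w]-th level; Fodor's lemma
    bounds the part of [side (a w)] below [w] by a fixed [b] for stationarily
    many [w]. The family [c w]
    takes [a] at such a point beyond [w], so that no member of [side (c w)] equals
    [w] or lies between [b] and [w]. A further use of Fodor's lemma bounds the
    ladder points below [w], and then the profiles are made constant. *)
Lemma condition_precaliber : precaliber_omega1 condition.
Proof.
move=> A uA.
have /choice[a aP] w : exists c, A c /\ ~ condition_level w c.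
  apply: contrapT => no; apply: uA.
  apply: sub_countable_set (condition_level_countable w) => c Ac.
  by apply: contrapT => nc; apply: no; exists c.
have fin_side (c : condition) : finite_set (side c) by have [] := conditionP c.
have [b largeS] := fodor_finite omegaW (large_setT omegaW)
  (fun w => fin_side (a w)).
rewrite setTI in largeS; set S := [set x | _] in largeS.
have /choice[s sP] w : exists x, S x /\ w < x.
  have [x Sx wx] := uncountable_above omegaW w (large_uncountable largeS).
  by exists x.
pose c w := a (s w).
have cA w : A (c w) by have [] := aP (s w).
have c_level w : ~ condition_level w (c w).
  move=> cw; have [_] := aP (s w); apply; apply: condition_level_mono cw.
  exact/ltW/(sP w).2.
have side_b w v : side (c w) v -> v <= b \/ w < v.
  have [Sw ws] := sP w; move=> cv; have [wv|vw] := ltP w v; [by right|left].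
  by apply: Sw cv _; exact: le_lt_trans ws.
have /choice[N0 N0P] w : exists N, forall v k, side (c w) v -> (N <= k)%N ->
    w < v -> w <= eta v k.
  apply: (@finite_nat_bound _ _ (fun v k => w < v -> w <= eta v k)) => // v _.
  have [wv|_] := ltP w v; last by exists 0.
  by have [K KP] := eta_cofinal wv; exists K => k /KP.
have [N largeN] := large_fiber N0 (large_setT omegaW).
have etaN w v k : N0 w = N -> side (c w) v -> w < v -> (N <= k)%N ->
    w <= eta v k.
  by move=> <- cv wv Nk; exact: N0P cv Nk wv.
have /choice[p pP] w : exists q, [/\ P0 q, q <= stem (c w) &
    forall v k, side (c w) v -> (k < N)%N -> exists n, q <= idx v k n].
  have [P0c finc _] := conditionP (c w).
  have [t ct] := (finite_seqP _).1 finc.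
  have [e|q [P0q qc qt]] := @meet_finitely_many _ _ P0
      [seq idx v k | v <- t, k <- iota 0 N] _ P0c.
    by move=> /allpairsP[[v k] [_ _ ->]].
  exists q; split=> // v k; rewrite ct => vt kN; apply: qt.
  by apply/allpairsP; exists (v, k); rewrite mem_iota.
(* The least index matters: validity of [c w] only gives some index, and
   agreement of reals is inherited by smaller ones. *)
have /choice[l0 l0P] (y : W * W * nat) : exists n,
    (exists m, p y.1.1 <= idx y.1.2 y.2 m) ->
    p y.1.1 <= idx y.1.2 y.2 n /\
    forall m, p y.1.1 <= idx y.1.2 y.2 m -> (n <= m)%N.
  have [ex|no] := pselect (exists m, p y.1.1 <= idx y.1.2 y.2 m); last first.
    by exists 0.
  by case: (ex_minnP ex) => n pn nmin; exists n.
pose l w v k := l0 (w, v, k).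
have l_met w v k : side (c w) v -> (k < N)%N -> p w <= idx v k (l w v k).
  by have [_ _ pw] := pP w; move=> cv /(pw _ _ cv) /(l0P (w, v, k))[].
have l_least w v k n : p w <= idx v k n -> (l w v k <= n)%N.
  by move=> pn; have [|_] := l0P (w, v, k); [exists n|exact].
have /choice[M MP] w : exists M, forall v k, side (c w) v -> (k < N)%N ->
    (l w v k <= M)%N.
  have [|M MP] := @finite_nat_bound _ _
      (fun v m => forall k, (k < N)%N -> (l w v k <= m)%N) (fin_side (c w)).
    move=> v _; exists (\max_(k < N) l w v k) => m Mm k kN.
    by apply: leq_trans Mm; exact: (leq_bigmax (Ordinal kN)).
  by exists M => v k cv; exact: MP cv (leqnn M) k.
rewrite setTI in largeN; set T1 := [set x | _] in largeN.
have [b' largeT2] := fodor_finite omegaW largeN (fun w =>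
  finite_image2 (fun v k => eta v k) (fin_side (c w)) (finite_II N)).
set T2 := (T1 `&` _)%classic in largeT2.
pose B := Order.max b b'.
have [g ginj] := countable_injP _ (omega1_segment omegaW B).
have /choice[t tP] w := (finite_seqP _).1 (fin_side (c w)).
have [data largeT3] := large_fiber
  (fun w => (M w, [seq profile B N M l g w v | v <- t w])) largeT2.
set T3 := (T2 `&` _)%classic in largeT3.
(* Precaliber of [P] comes last among the choices: it yields an uncountable set,
   which need not be stationary. *)
have [T4 [T43 uT4 centT4]] :=
  precaliber_family precP p (large_uncountable largeT3).
have uT4B : ~ countable [set w | T4 w /\ B < w].
  move=> cT4; apply: uT4.
  apply: sub_countable_set
    (countable_setU cT4 (omega1_segment omegaW B)) => w T4w.
  by have [wB|Bw] := leP w B; [right|left].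
have /choice[top topP] w := countable_bounded omegaW
  (finite_set_countable (fin_side (c w))).
have [T [TT4 uT sparseT]] := sparse_uncountable omegaW top uT4B.
have TT3 w : T w -> T3 w by move=> /TT4[/T43].
exists (c @` T); split.
- by move=> _ [w _ <-].
- move=> ccT; have /choice[lev levP] := condition_level_ex.
  have [w0 w0P] := countable_bounded omegaW (countable_image lev ccT).
  have [w Tw w0w] := uncountable_above omegaW w0 uT.
  apply: (c_level w); apply: condition_level_mono (levP (c w)).
  by apply/ltW/(lt_trans _ w0w)/w0P; exists (c w) => //; exact: imageP.
move=> F finF FcT; have [G [finG GT ->]] := finite_sub_image finF FcT.
have [q0 q0P] : lbound (p @` G) !=set0.
  apply: centT4; first exact: finite_image.
  by move=> _ [w Gw <-]; exists w => //; exact: (TT4 _ (GT _ Gw)).1.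
have [|q P0q qP] := closedP0 (finite_image p finG) _ (ex_intro _ q0 q0P).
  by move=> _ [w _ <-]; have [] := pP w.
have qp w : G w -> q <= p w by move=> Gw; apply: qP; exact: imageP.
have tq : tied q (\bigcup_(w in G) side (c w)).
  apply: (@thin_tied c p B N M l g T) => //.
  - by move=> w v /side_b[vb|]; [left; rewrite le_max vb|right].
  - by move=> w; have [] := pP w.
  - by move=> w v k /TT3[[T1w _] _]; exact: etaN.
  - move=> w w' v Tw Tw' ww' cv.
    by apply: lt_trans (sparseT _ _ Tw Tw' ww'); exact: topP.
  - by move=> w /TT4[].
  - move=> w v k /TT3[[_ T2w] _] cv kN vw.
    rewrite le_max (T2w (eta v k)) ?orbT//.
    by exists v => //; exists k.
  - move=> w w' v /TT3[_ ew] /TT3[_ ew'].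
    rewrite tP /= => vt.
    have : profile B N M l g w v \in [seq profile B N M l g w' v | v <- t w'].
      by have [_ ->] := etrans ew' (esym ew); exact: map_f.
    by move=> /mapP[v' v't ->]; exists v' => //; rewrite tP.
  - by move=> w w' /TT3[_ ew] /TT3[_ ew']; have [->] := etrans ew (esym ew').
have [c' [c'q c'G]] : exists c' : condition, stem c' = q /\
    side c' = \bigcup_(w in G) side (c w).
  have cond : [/\ P0 q, finite_set (\bigcup_(w in G) side (c w)) &
      tied q (\bigcup_(w in G) side (c w))] by split=> //; exact: bigcup_finite.
  by exists (Condition cond).
exists c' => _ [w Gw <-]; apply/condition_leP; rewrite c'q c'G; split.
  by have [_ pc _] := pP w; exact: le_trans (qp w Gw) pc.
by move=> v cv; exists w.
Qed.

(** * A generic centered set from a sigma-centered poset *)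

Section Generic.
Context (p0 : P) (E : W -> set (nat -> P)).
Hypothesis P0p0 : P0 p0.
Hypothesis Emono : forall v w, v <= w -> E v `<=` E w.
Hypothesis idxE : forall w, E w = range (idx w).

Let conditionP1 x : [/\ P0 p0, finite_set [set x] & tied p0 [set x]].
Proof. by split; [|exact: finite_set1|exact: tied_set1]. Qed.

Definition condition1 (x : W) : condition := Condition (conditionP1 x).

Lemma condition_omega1 : card_omega1 [set: condition].
Proof.
apply: (card_omega1_filtration omegaW condition_level_mono
  condition_level_countable condition_level_ex) => cT.
apply: (omega1_uncountable omegaW); apply: sub_countable_set
  (countable_preimage_inj _ cT : countable (condition1 @^-1` [set: condition])).
  by [].
move=> x y /(congr1 (fun c => side c)) /= e.
by have : [set x] x by []; rewrite e.
Qed.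

(** On the points without a partner at [k], the regressive map [eta^~ k] is
    injective, so by Fodor's lemma they form a nonstationary set. *)
Lemma partners S : large S ->
  ~ countable [set x | S x /\ forall k, exists y,
    [/\ S y, x <> y & eta x k = eta y k]].
Proof.
set S' := [set x | _] => lS cS'.
pose alone k := [set x | S x /\
  ~ exists y, [/\ S y, x <> y & eta x k = eta y k]].
have [m mmin] := omega1_least omegaW.
have lS' := large_setD_countable (large_setD_countable lS cS')
  (finite_set_countable (finite_set1 m)).
have [|k lk] := @large_cover _ _ _ alone lS'.
  move=> x [[Sx nS'x] _]; apply: contrapT => no; apply: nS'x; split=> // k.
  by apply: contrapT => nk; apply: no; exists k.
have [x [[_ xm] _]|v lv] := fodor omegaW lk (h := eta^~ k).
  apply: (@etaS m); rewrite lt_neqAle mmin andbT eq_sym.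
  exact/eqP.
have [x [[[[Sx _] _] [_ alone_x]] ex] _] :=
  uncountable_above omegaW m (large_uncountable lv).
have [y [[[[Sy _] _] _] ey] xy] :=
  uncountable_above omegaW x (large_uncountable lv).
apply: alone_x; exists y; split=> //; last by rewrite ex ey.
by move=> e; rewrite e ltxx in xy.
Qed.

(** Compactness: [S] is good if any finite part of it is met by conditions with
    arbitrarily large finite sides in [X]. *)
Let good X (S : set P) := S `<=` P0 /\ forall F S0, finite_set F -> F `<=` X ->
  finite_set S0 -> S0 `<=` S ->
  exists c : condition, F `<=` side c /\ lbound S0 (stem c).

(** Let [X] be stationary such that all [condition1 x] with [x] in [X]
    lie in one centered piece. A maximal good set contains a term of each
    sequence: [x] in [X] and its partner [y] confine the sequence to the terms
    up to [N]; if none of these could be added, a condition whose side contains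
    [x], [y] and the finitely many obstacles would be below none of them. *)
Lemma generic_of_sigma_centered : sigma_centered condition ->
  exists S, [/\ S `<=` P0, centered S & forall w e, E w e -> exists n, S (e n)].
Proof.
move=> [C [cC centC coverC]].
have inC c : exists2 Z, C Z & Z c.
  by have : (\bigcup_(Z in C) Z) c by rewrite coverC.
have [m _] := omega1_least omegaW.
have [|Z CZ] := countable_range cC.
  by have [Z CZ _] := inC (condition1 m); exists Z.
have [|n lX] := large_cover (F := fun n => [set x | Z n (condition1 x)])
    (large_setT omegaW).
  by move=> x _; have [Y + Yx] := inC (condition1 x); rewrite CZ => -[n _ eY];
    exists n => //; rewrite /= eY.
rewrite setTI in lX; set X := [set x | _] in lX.
have centX F : finite_set F -> F `<=` X -> exists c : condition, F `<=` side c.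
  move=> finF FX; have [|||c cF] := centC (Z n) _ (condition1 @` F).
  - by rewrite CZ; exact: imageT.
  - exact: finite_image.
  - by move=> _ [x Fx <-]; exact: FX.
  exists c => x Fx; have /condition_leP[_] := cF _ (imageP condition1 Fx).
  exact.
have [||S [goodS maxS]] := @finite_character_maximal P (good X).
- split=> // F S0 finF FX _ S00; have [c cF] := centX F finF FX.
  by exists c; split=> // q /S00.
- move=> S; split=> [[SP0 gS] S0 finS0 S0S|gS].
    split=> [q /S0S/SP0//|F S1 finF FX finS1 S1S0].
    by apply: gS => // q /S1S0/S0S.
  split=> [q Sq|F S0 finF FX finS0 S0S].
    have [|q' ->//|+ _] := gS [set q]; first exact: finite_set1.
    exact.
  by have [_] := gS S0 finS0 S0S; apply.
have [SP0 gS] := goodS.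
exists S; split=> // [S0 finS0 S0S|w e Ewe].
  have [//|c [_ cS0]] := gS set0 S0 (finite_set0 _) _ finS0 S0S.
  by exists (stem c).
have [x [Xx px] wx] := uncountable_above omegaW w (partners lX).
have [k ek] : exists k, idx x k = e.
  have : E x e by exact: Emono (ltW wx) _ Ewe.
  by rewrite idxE => -[k _ <-]; exists k.
have [y [Xy xy exy]] := px k.
have [N uN] : exists N, u x N <> u y N.
  apply: contrapT => /forallNP uxy; apply: xy; apply: uinj; apply: funext => N.
  exact: contrapT (uxy N).
apply: contrapT => /forallNP nS.
have /choice[bad badP] i : exists FS : set W * set P, [/\ finite_set FS.1,
    FS.1 `<=` X, finite_set FS.2, FS.2 `<=` e i |` S &
    forall c : condition, FS.1 `<=` side c -> ~ lbound FS.2 (stem c)].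
  apply: contrapT => no; apply: (nS i); apply: maxS; split.
    move=> q [->|/SP0//]; rewrite -ek; exact: (idxP x k).1.
  move=> F S0 finF FX finS0 S0S; apply: contrapT => nc; apply: no.
  by exists (F, S0); split=> // c Fc S0c; apply: nc; exists c.
pose F := [set x; y] `|` \bigcup_(i in [set i | (i <= N)%N]) (bad i).1.
pose S0 := \bigcup_(i in [set i | (i <= N)%N]) ((bad i).2 `&` S).
have finN : finite_set [set i | (i <= N)%N] by exact: finite_II N.+1.
have [||||c [cF cS0]] := gS F S0.
- rewrite /F finite_setU; split.
    by rewrite finite_setU; split; exact: finite_set1.
  by apply: bigcup_finite => // i _; have [] := badP i.
- by move=> z [[->|->]//|[i _ Fz]]; have [_ + _ _ _] := badP i; apply.
- apply: bigcup_finite => // i _; have [_ _ finS0 _ _] := badP i.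
  by apply: sub_finite_set finS0 => q [].
- by move=> q [i _ []].
have [_ _ /(_ x y k)] := conditionP c; case=> //.
- by apply: cF; left; left.
- by apply: cF; left; right.
rewrite ek => i [axy ci].
have iN : (i <= N)%N by rewrite leqNgt; apply/negP => /axy.
have [_ _ _ iS /(_ c)] := badP i; apply=> [z Fz|q iq].
  by apply: cF; right; exists i.
by have [->//|Sq] := iS q iq; apply: cS0; exists i.
Qed.

End Generic.
End Core.

(** * Reduction to a subset of size [omega_1] *)

Section Closure.
Context (d : Order.disp_t) (P : porderType d).
Context (dW : Order.disp_t) (W : orderType dW).
Hypothesis omegaW : omega1_order (<=%O : rel W).
Context (D : W -> set P) (below : W -> seq P -> P).
Hypothesis belowP : forall w l, lbound [set` l] !=set0 ->
  D w (below w l) /\ lbound [set` l] (below w l).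

Inductive closure (w : W) : P -> Prop :=
  Closure v l : v <= w -> (forall q, q \in l -> closure w q) ->
    closure w (below v l).

Lemma closure_mono v w : v <= w -> closure v `<=` closure w.
Proof.
move=> vw p; elim=> x l xv _ IHl; apply: Closure IHl; exact: le_trans vw.
Qed.

(** A member is the value of a finite tree labelled by the countable segment
    of [w]. *)
Lemma closure_countable w : countable (closure w).
Proof.
have [f fP] := segment_enumeration omegaW.
pose ev := fix ev (t : GenTree.tree nat) : P := match t with
  | GenTree.Leaf n => below (f w n) [::]
  | GenTree.Node n ts => below (f w n) (map ev ts) end.
apply: (@sub_countable_set _ _ (range ev)); last exact: countable_image.
move=> p; elim=> v l vw _ IHl.
have [n <-] := (fP w v).1 vw.
suff [ts <-] : exists ts, map ev ts = l by exists (GenTree.Node n ts).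
elim: l IHl => [|q l IH] IHl; first by exists [::].
have [t _ <-] := IHl q (mem_head q l).
have [x xl|ts <-] := IH; first by apply: IHl; rewrite inE xl orbT.
by exists (t :: ts).
Qed.

Definition hull : set P := \bigcup_w closure w.

Lemma hull_lower_bound F w : finite_set F -> F `<=` hull -> lbound F !=set0 ->
  exists q, [/\ hull q, D w q & lbound F q].
Proof.
move=> /finite_seqP[l ->] lP lb0.
suff [v wv lv] : exists2 v, w <= v & forall q, q \in l -> closure v q.
  have [Dq lq] := belowP w lb0; exists (below w l); split=> //.
  by exists v => //; exact: Closure.
elim: l lP {lb0} => [|q l IHl] lP; first by exists w.
have [x xl|v wv lv] := IHl; first by apply: lP; rewrite /= inE xl orbT.
have [v' _ qv'] := lP q (mem_head q l).
exists (Order.max v v') => [|x]; first by rewrite le_max wv.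
rewrite inE => /orP[/eqP->|/lv].
  by apply: closure_mono qv'; rewrite le_max lexx orbT.
by apply: closure_mono; rewrite le_max lexx.
Qed.

End Closure.

Theorem theorem5 : P_omega1_precaliber_sigma_centered -> MA_omega1_precaliber.
Proof.
move=> H d P precP X [W0 [R [omegaR XW]]] denseX.
have [D [DX Dinj Dsurj]] := card_set_bijP (card_esym XW).
pose W := omega1_carrier omegaR.
have omegaW := omega1_carrierP omegaR : omega1_order (<=%O : rel W).
have {}DX w : X (D w) by exact: DX.
have [m _] := omega1_least omegaW.
(* [P] is nonempty, as its powerset contains uncountably many dense sets. *)
have [p0 _] : [set: P] !=set0.
  apply: contrapT => P0; apply: (omega1_uncountable omegaW).
  apply/countable_injP; exists (fun=> 0) => v w _ _ _.
  apply: Dinj; rewrite ?inE//.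
  by apply: funext => p; case: P0; exists p.
have /choice[below1 below1P] (wl : W * seq P) :
    exists q, lbound [set` wl.2] !=set0 ->
    D wl.1 q /\ lbound [set` wl.2] q.
  have [[p lp]|no] := pselect (lbound [set` wl.2] !=set0); last by exists p0.
  have [q Dq qp] := denseX _ (DX wl.1) p.
  by exists q; split=> // x /lp; exact: le_trans.
pose below (w : W) l := below1 (w, l).
have belowP (w : W) l := below1P (w, l) :
  _ -> D w (below w l) /\ lbound [set` l] (below w l).
pose P0 := hull below.
have hullP F w := @hull_lower_bound _ P _ W D below belowP F w.
have closedP0 : lower_bound_closed P0.
  move=> F finF FP0 lF; have [q [P0q _ lq]] := hullP F m finF FP0 lF.
  by exists q.
have P0ne : P0 !=set0.
  have [|q [P0q _ _]] := hullP set0 m (finite_set0 _) (fun _ => False_ind _).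
    by exists p0.
  by exists q.
have fin2 (p q : P) : finite_set [set p; q].
  by rewrite finite_setU; split; exact: finite_set1.
have /choice[e1 e1P] (w : W) :
    exists e, predense_in P0 e /\ forall n, D w (e n).
  apply: countable_predense => // p P0p.
  have [||q [P0q Dq qp]] := hullP [set p] w (finite_set1 p).
  - by move=> _ ->.
  - by exists p => _ ->.
  - by exists q; split=> //; exact: qp.
(* A centered set that contains [a] and [b] can meet this dense set only in
   a common lower bound of the two. *)
pose split_by a b := [set r : P | [\/ r <= a /\ r <= b,
  ~ (lbound [set r; a] !=set0) | ~ (lbound [set r; b] !=set0)]].
have /choice[e2 e2P] (ab : P * P) : exists e, P0 ab.1 -> P0 ab.2 ->
    predense_in P0 e /\ forall n, split_by ab.1 ab.2 (e n).
  case: ab => a b /=.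
  have [[P0a P0b]|no] := pselect (P0 a /\ P0 b); last first.
    by exists (fun=> p0) => P0a P0b; case: no.
  suff [e eP] : exists e, predense_in P0 e /\ forall n, split_by a b (e n).
    by exists e.
  apply: countable_predense => // p P0p.
  have [pa|pa] := pselect (lbound [set p; a] !=set0); last first.
    by exists p; split=> //; exact: Or32.
  have [|q P0q lq] := closedP0 _ (fin2 p a) _ pa; first by move=> x [->|->].
  have [qp qa] : q <= p /\ q <= a by split; apply: lq; [left|right].
  have [qb|qb] := pselect (lbound [set q; b] !=set0); last first.
    by exists q; split=> //; exact: Or33.
  have [|r P0r lr] := closedP0 _ (fin2 q b) _ qb; first by move=> x [->|->].
  have [rq rb] : r <= q /\ r <= b by split; apply: lr; [left|right].
  exists r; split=> //; last exact: le_trans qp.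
  by apply: Or31; split=> //; exact: le_trans qa.
pose E (w : W) := (e1 @` [set v | v <= w]) `|`
  (e2 @` (closure below w `*` closure below w)).
have closureP0 w : closure below w `<=` P0 by move=> p pw; exists w.
have Emono v w : v <= w -> E v `<=` E w.
  move=> vw e [[x xv <-]|[[a b] [av bv] <-]].
    by left; exists x => //; exact: le_trans vw.
  by right; exists (a, b) => //; split; exact: closure_mono vw _ _.
have Epredense w e : E w e -> predense_in P0 e.
  move=> [[v _ <-]|[[a b] [av bv] <-]]; first exact: (e1P v).1.
  by have [] := e2P (a, b) (closureP0 _ _ av) (closureP0 _ _ bv).
have /choice[idx idxE] w : exists i : nat -> nat -> P, E w = range i.
  apply: countable_range; last by exists (e1 w); left; exists w => /=.
  apply: countable_setU; apply: countable_image.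
    exact: omega1_segment.
  by apply: countableX; exact: closure_countable.
have idxP w k : predense_in P0 (idx w k).
  by apply: (Epredense w); rewrite idxE; exact: imageT.
have [eta [etaW etaS eta_cof]] := ladder_system omegaW.
have [u uinj] := omega1_reals omegaW.
have P0lev p : P0 p -> exists w, closure below w p by move=> [w _ pw]; exists w.
have [q0 P0q0] := P0ne.
have Lmono := closure_mono (below := below).
have Lcount := closure_countable omegaW below.
have cardQ := condition_omega1 eta u idx omegaW Lmono Lcount P0lev P0q0.
have precQ : precaliber_omega1 (condition P0 eta u idx).
  exact: condition_precaliber etaW eta_cof idxP Lmono Lcount P0lev.
have [S [SP0 centS SE]] := generic_of_sigma_centered omegaW etaS uinj idxP P0q0
  Emono idxE (H _ _ cardQ precQ).
have dirS a b : S a -> S b -> exists r, [/\ S r, r <= a & r <= b].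
  move=> Sa Sb; have [[v _ av] [w _ bw]] := (SP0 _ Sa, SP0 _ Sb).
  have [|n Sn] := SE (Order.max v w) (e2 (a, b)).
    right; exists (a, b) => //; split=> /=.
      by apply: closure_mono av; rewrite le_max lexx.
    by apply: closure_mono bw; rewrite le_max lexx orbT.
  have [_ /(_ n)] := e2P (a, b) (SP0 _ Sa) (SP0 _ Sb).
  have cent2 p q : S p -> S q -> lbound [set p; q] !=set0.
    by move=> Sp Sq; apply: centS => // x [->|->].
  case=> [[ra rb]|[]|[]]; [|exact: cent2..].
  by exists (e2 (a, b) n).
have SD w : exists2 r, S r & D w r.
  have [|n Sn] := SE w (e1 w); first by left; exists w => /=.
  by exists (e1 w n) => //; exact: (e1P w).2.
exists [set p | exists2 s, S s & s <= p]; split; last first.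
  move=> _ /Dsurj[w _ <-]; have [r Sr Dr] := SD w.
  by exists r; split=> //; exists r.
split=> [p q [s Ss sp] pq|F finF FG].
  by exists s => //; exact: le_trans pq.
suff [s Ss sF] : exists2 s, S s & lbound F s by exists s => //; exists s.
have [l Fl] := (finite_seqP _).1 finF; move: FG; rewrite Fl {Fl}.
elim: l => [|p l IHl] lG; first by have [r Sr _] := SD m; exists r.
have [x xl|s Ss sl] := IHl; first by apply: lG; rewrite /= inE xl orbT.
have [t St tp] := lG p (mem_head p l).
have [r [Sr rs rt]] := dirS s t Ss St.
exists r => // x /=; rewrite inE => /orP[/eqP->|xl]; first exact: le_trans tp.
by apply: le_trans rs _; exact: sl.
Qed.
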